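(* No subsemigroup of $\mathbb{N}^0$, except the trivial subsemigroup $\{0\}$ consisting of the adjoined zero alone, is an automaton semigroup.
   Context: $\mathbb{N}$ denotes the free semigroup of rank $1$, i.e. the additive semigroup $(\{1,2,3,\dots\},+)$ of positive integers. $\mathbb{N}^0$ denotes $\mathbb{N}$ with a zero element adjoined, i.e. $\mathbb{N}\cup\{0\}$ where the new element $0$ is absorbing: its product with any element (on either side) is $0$ itself. (It is not to be confused with the monoid of non-negative integers under addition; here $0$ is a semigroup zero, not an additive identity.) Subsemigroups are non-empty. An automaton is a triple $\mathcal{A}=(Q,B,\delta)$ where $Q$ is a finite set of states, $B$ is a finite alphabet of symbols, and $\delta$ is a transformation of $Q\times B$ (a map $Q\times B\to Q\times B$). Each state $q\in Q$ acts on the right on the set $B^*$ of finite words over $B$: for $\alpha=\alpha_1\alpha_2\cdots\alpha_n\in B^*$, $\alpha\cdot q=\beta_1\beta_2\cdots\beta_n$ where $q_0=q$ and $(q_{i-1},\alpha_i)\delta=(q_i,\beta_i)$ for $i=1,\dots,n$. A non-empty word $w=w_1\cdots w_m\in Q^+$ acts by $\alpha\cdot w=(\cdots((\alpha\cdot w_1)\cdot w_2)\cdots)\cdot w_m$. Regarding $B^*$ as a rooted tree (the children of $\alpha$ are the words $\alpha b$, $b\in B$), this gives a homomorphism $\phi:Q^+\to\operatorname{End}B^*$ to the endomorphism semigroup of the tree (maps written on the right); its image is denoted $\Sigma(\mathcal{A})$. A semigroup $S$ is an automaton semigroup if there is an automaton $\mathcal{A}$ with $S\simeq\Sigma(\mathcal{A})$.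 *)

(* Defs.v *)
From HB Require Import structures.
From mathcomp Require Import all_boot.
From mathcomp Require Import boolp classical_sets functions.

Set Implicit Arguments.
Unset Strict Implicit.
Unset Printing Implicit Defensive.

Local Open Scope classical_set_scope.
Local Open Scope group_scope.

Definition subsemigroup (G : semigroupType) (S : set G) : Prop :=
  S !=set0 /\ forall x y, S x -> S y -> S (x * y).

(* Isomorphism of the subsemigroups S of G and T of H; only the values of h on
   S matter. *)
Definition subsemigroup_isog (G H : semigroupType) (S : set G) (T : set H) :
    Prop :=
  exists2 h : G -> H,
    set_bij S T h & forall x y, S x -> S y -> h (x * y) = h x * h y.

(* The free semigroup of rank 1, written multiplicatively although its law is
   the addition of positive integers. *)
Definition posnat : Type := {n : nat | (0 < n)%N}.

HB.instance Definition _ := Choice.on posnat.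

Definition posnat_add (m n : posnat) : posnat :=
  exist _ (val m + val n)%N (ltn_addr (val n) (valP m)).

Fact posnat_addA : associative posnat_add.
Proof. by move=> m n p; apply: val_inj => /=; rewrite addnA. Qed.

HB.instance Definition _ := isSemigroup.Build posnat posnat_addA.

(* The semigroup T with a new absorbing element None adjoined. *)
Definition adjoin0 (T : Type) : Type := option T.

HB.instance Definition _ (T : choiceType) := Choice.copy (adjoin0 T) (option T).

Section Adjoin0.
Variable G : semigroupType.

Definition adjoin0_mul (x y : adjoin0 G) : adjoin0 G :=
  if x is Some a then if y is Some b then Some (a * b) else None else None.

Fact adjoin0_mulA : associative adjoin0_mul.
Proof. by move=> [a|] [b|] [c|] //=; rewrite mulgA. Qed.

HB.instance Definition _ := isSemigroup.Build (adjoin0 G) adjoin0_mulA.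
End Adjoin0.

Definition N0 : semigroupType := adjoin0 posnat.

Definition N0_zero : N0 := @None posnat.

Section TreeEndomorphisms.
Variable B : choiceType.

(* The root is fixed and every child of a word goes to a child of its image. *)
Definition is_tree_endo (f : seq B -> seq B) : Prop :=
  f [::] = [::] /\
  forall (a : seq B) (b : B), exists c : B, f (rcons a b) = rcons (f a) c.

Definition tree_endo : Type := {f : seq B -> seq B | `[< is_tree_endo f >]}.

HB.instance Definition _ := gen_eqMixin tree_endo.
HB.instance Definition _ := gen_choiceMixin tree_endo.

Lemma tree_endo_inj (f g : tree_endo) : sval f = sval g -> f = g.
Proof. by move=> fg; apply: val_inj. Qed.

(* Maps act on the right: f * g is f followed by g. *)
Fact comp_is_tree_endo (f g : tree_endo) :
  `[< is_tree_endo (sval g \o sval f) >].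
Proof.
case: f g => [f /asboolP[f0 fS]] [g /asboolP[g0 gS]] /=.
apply/asboolP; split=> [|a b] /=; first by rewrite f0.
by have [c ->] := fS a b; exact: gS.
Qed.

Definition tree_endo_mul (f g : tree_endo) : tree_endo :=
  exist _ (sval g \o sval f) (comp_is_tree_endo f g).

Fact tree_endo_mulA : associative tree_endo_mul.
Proof. by move=> f g h; apply: tree_endo_inj. Qed.

HB.instance Definition _ := isSemigroup.Build tree_endo tree_endo_mulA.
End TreeEndomorphisms.

Record automaton : Type := Automaton {
  state : finType;
  symbol : finType;
  delta : state * symbol -> state * symbol
}.

Section AutomatonAction.
Variable A : automaton.

Fixpoint state_act (q : state A) (a : seq (symbol A)) : seq (symbol A) :=
  if a is x :: a' then
    let: (p, y) := @delta A (q, x) in y :: state_act p a'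
  else [::].

Definition word_act (w : seq (state A)) (a : seq (symbol A)) :
    seq (symbol A) :=
  foldl (fun b q => state_act q b) a w.

Fact state_act_is_tree_endo (q : state A) : is_tree_endo (state_act q).
Proof.
split=> // a; elim: a q => [|x a IHa] q b /=.
  by case: (delta _) => p y; exists y.
by case: (delta _) => p y; have [c ->] := IHa p b; exists c.
Qed.

Fact word_act_is_tree_endo (w : seq (state A)) :
  `[< is_tree_endo (word_act w) >].
Proof.
apply/asboolP; elim: w => [|q w [w0 wS]]; first by split=> // a b; exists b.
split=> // a b; rewrite /word_act /=.
by have [c ->] := (state_act_is_tree_endo q).2 a b; exact: wS.
Qed.

Definition word_endo (w : seq (state A)) : tree_endo (symbol A) :=
  exist _ (word_act w) (word_act_is_tree_endo w).

Lemma word_endo_cat (v w : seq (state A)) :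
  word_endo (v ++ w) = word_endo v * word_endo w.
Proof.
by apply: tree_endo_inj; apply/funext => a; rewrite /= /word_act foldl_cat.
Qed.

Definition Sigma : set (tree_endo (symbol A)) :=
  word_endo @` [set w | w <> [::]].
End AutomatonAction.

Definition automaton_semigroup (G : semigroupType) (S : set G) : Prop :=
  exists A : automaton, subsemigroup_isog S (@Sigma A).

(* Main.v *)
Require Import Defs.
From mathcomp Require Import all_boot.
From mathcomp Require Import boolp classical_sets functions.

Local Open Scope classical_set_scope.

(** Suppose that an automaton semigroup is isomorphic to a subsemigroup [S] of
    N^0 having a nonzero element. A state then carries an exponent: a positive
    integer, or the adjoined zero. The idea is to play the largest positive
    exponent [k], carried by a state [q], against the smallest one [l], carried
    by a state [p].

    The words [q^l] and [p^k] both have exponent [l k], so they act alike on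
    the tree, and so do their sections at any letter [b]. Those sections are
    words of lengths [l] and [k]. If their common exponent is not zero, it is
    at most [l k], being a sum of [l] terms at most [k], and at least [k l],
    being a sum of [k] terms at least [l]. So every section of [y = q^l] at a
    letter is [y] or zero ([balanced_power_section]).

    Consequently a section of [y^n] at a letter is [y^n] or zero, and [y^n] is
    determined by a finite amount of data: where it sends each letter, and at
    which letters its section vanishes ([power_act_eq_first_letter]). By the
    pigeonhole principle two distinct powers of [y] coincide, which is absurd
    because positive integers have infinite order
    ([no_self_similar_powers]). Hence every state has exponent zero
    ([all_exponents_zero]).

    Conversely, [{0}] is the semigroup of the automaton with one state and one
    symbol ([automaton_semigroup_zero]). *)

(** * Sections of words of states *)

Section WordSections.
Context {A : automaton}.
Implicit Types (u v w : seq (state A)) (b : symbol A).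

(** The section of a word at a letter, together with the image of that letter:
    the transition function of the automaton extended to words of states. *)
Fixpoint word_step w b : seq (state A) * symbol A :=
  if w is q :: w' then
    let: (p, c) := delta (q, b) in
    let: (u, d) := word_step w' c in (p :: u, d)
  else ([::], b).

Lemma word_act_cons w b a :
  word_act w (b :: a) = (word_step w b).2 :: word_act (word_step w b).1 a.
Proof.
elim: w b a => [|q w IHw] b a //=; rewrite /word_act /=.
case: (delta _) => p c; rewrite -/(word_act _ _) IHw.
by case: (word_step w c).
Qed.

Lemma word_act_nil w : word_act w [::] = [::].
Proof. by elim: w. Qed.

Lemma size_word_section w b : size (word_step w b).1 = size w.
Proof.
elim: w b => [|q w IHw] b //=; case: (delta _) => p c.
by have := IHw c; case: (word_step w c) => u d /= ->.
Qed.

Lemma word_section_cat u v b :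
  (word_step (u ++ v) b).1 =
  (word_step u b).1 ++ (word_step v (word_step u b).2).1.
Proof.
elim: u b => [|q u IHu] b //=; case: (delta _) => p c.
have := IHu c; case: (word_step u c) => u' d /= <-.
by case: (word_step (u ++ v) c).
Qed.

Lemma word_section_act_eq u v b :
  word_act u =1 word_act v ->
  word_act (word_step u b).1 =1 word_act (word_step v b).1.
Proof. by move=> uv a; have := uv (b :: a); rewrite !word_act_cons => -[]. Qed.

Definition word_power w n : seq (state A) := flatten (nseq n w).

Lemma word_power_neq0 w n : w <> [::] -> (0 < n)%N -> word_power w n <> [::].
Proof. by case: w => // q w _; case: n. Qed.

End WordSections.

(** * Exponents *)

(** The product in N^0 of a sequence of elements, when the adjoined zero is
    encoded by the number 0. *)
Definition exponent_prod (s : seq nat) : nat :=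
  if 0 \in s then 0 else sumn s.

Lemma exponent_prod_cons n s :
  s <> [::] ->
  exponent_prod (n :: s) =
  if (n == 0) || (exponent_prod s == 0) then 0 else n + exponent_prod s.
Proof.
move=> s0; rewrite /exponent_prod inE eq_sym; case: eqP => //= _.
case: ifP => //= zs; case: ifP => // /eqP sums.
by case: s s0 sums zs => // -[|m] s.
Qed.

Lemma exponent_prod_cat s t :
  exponent_prod (s ++ t) =
  if (0 \in s) || (0 \in t) then 0 else exponent_prod s + exponent_prod t.
Proof.
by rewrite /exponent_prod mem_cat sumn_cat; case: (0 \in s); case: (0 \in t).
Qed.

Lemma exponent_prod_eq0 s : s <> [::] -> (exponent_prod s == 0) = (0 \in s).
Proof.
rewrite /exponent_prod; case: ifP => // zs s0; apply/eqP.
by case: s s0 zs => // -[|m] s.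
Qed.

Lemma sumn_le_size s k : {in s, forall n, n <= k} -> sumn s <= size s * k.
Proof.
elim: s => //= n s IHs sk; rewrite mulSn leq_add ?sk ?mem_head //.
by apply: IHs => m ms; rewrite sk // in_cons ms orbT.
Qed.

Lemma sumn_ge_size s l : {in s, forall n, l <= n} -> size s * l <= sumn s.
Proof.
elim: s => //= n s IHs sl; rewrite mulSn leq_add ?sl ?mem_head //.
by apply: IHs => m ms; rewrite sl // in_cons ms orbT.
Qed.

Lemma exponent_prod_nseq n k : (0 < k)%N -> exponent_prod (nseq n k) = n * k.
Proof.
by case: k => // k _; rewrite /exponent_prod mem_nseq andbF sumn_nseq mulnC.
Qed.

(** * Automata whose words are classified by their exponents *)

Section Exponents.
Context {A : automaton} (c : state A -> nat).
Implicit Types (u v w : seq (state A)) (b : symbol A).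

Definition word_exponent w : nat := exponent_prod (map c w).

(* Over words that act as elements of a subsemigroup of N^0, equality of
   endomorphisms is equality of exponents. *)
Hypothesis act_eqP : forall u v, u <> [::] -> v <> [::] ->
  word_act u =1 word_act v <-> word_exponent u = word_exponent v.

Let section_neq0 w b : w <> [::] -> (word_step w b).1 <> [::].
Proof. by case: w => [//|q w] _ /(congr1 size); rewrite size_word_section. Qed.

Let map_neq0 w : w <> [::] -> map c w <> [::].
Proof. by case: w. Qed.

Let section_exponent_eq u v b : u <> [::] -> v <> [::] ->
  word_exponent u = word_exponent v ->
  word_exponent (word_step u b).1 = word_exponent (word_step v b).1.
Proof.
move=> u0 v0 /(act_eqP _ _ u0 v0) uv.
by apply/act_eqP; [exact: section_neq0..|exact: word_section_act_eq].
Qed.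

(** The words [q^l] and [p^k] act alike, so at each letter their sections have
    the same exponent; counting terms with the larger bound on one side and the
    smaller bound on the other leaves only one nonzero value. *)
Lemma balanced_power_section p q b :
  (0 < c p)%N ->
  (forall r, (0 < c r)%N -> (c p <= c r <= c q)%N) ->
  let y := nseq (c p) q in
  word_exponent (word_step y b).1 = 0 \/
  word_exponent (word_step y b).1 = word_exponent y.
Proof.
move=> p0 minmax y; pose z := nseq (c q) p.
have q0 : (0 < c q)%N.
  by apply: (leq_trans p0); case/andP: (minmax p p0).
have y0 : y <> [::] by rewrite /y; case: (c p) p0.
have z0 : z <> [::] by rewrite /z; case: (c q) q0.
have ey : word_exponent y = c p * c q.
  by rewrite /word_exponent map_nseq exponent_prod_nseq.
have ez : word_exponent z = c p * c q.
  by rewrite /word_exponent map_nseq exponent_prod_nseq // mulnC.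
have yz : word_exponent (word_step y b).1 = word_exponent (word_step z b).1.
  by apply: section_exponent_eq; rewrite // ey ez.
have [|pos] := eqVneq (word_exponent (word_step y b).1) 0; [by left|right].
have bounds w : word_exponent w != 0 ->
    (size w * c p <= word_exponent w <= size w * c q)%N.
  rewrite /word_exponent /exponent_prod; case: ifPn => // /negP zw _.
  have mm n : n \in map c w -> (c p <= n <= c q)%N.
    move=> nw; case/mapP: (nw) => r _ nr; rewrite nr; apply: minmax.
    by rewrite lt0n; apply/eqP => r0; apply: zw; rewrite -r0 -nr.
  apply/andP; rewrite -(size_map c w); split.
    by apply: sumn_ge_size => n /mm /andP[].
  by apply: sumn_le_size => n /mm /andP[].
apply/eqP; rewrite eqn_leq {2}yz ey.
have /andP[_ ub] := bounds _ pos.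
rewrite yz in pos; have /andP[lb _] := bounds _ pos.
rewrite !size_word_section !size_nseq in ub lb.
by rewrite ub mulnC lb.
Qed.

Section SelfSimilarPowers.
Variable y : seq (state A).
Hypothesis y_pos : (0 < word_exponent y)%N.
Hypothesis y_section : forall b,
  word_exponent (word_step y b).1 = 0 \/
  word_exponent (word_step y b).1 = word_exponent y.

Let y0 : y <> [::].
Proof. by move=> y_nil; move: y_pos; rewrite y_nil. Qed.

Lemma word_exponent_power n :
  0 \notin map c (word_power y n) /\
  word_exponent (word_power y n) = n * word_exponent y.
Proof.
have zy : 0 \notin map c y.
  by rewrite -exponent_prod_eq0 -?lt0n //; exact: map_neq0.
elim: n => [|n [zn en]] //.
rewrite mulSn -en /word_exponent /word_power /= map_cat exponent_prod_cat.
by rewrite mem_cat (negbTE zy) (negbTE zn).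
Qed.

(** Sections of [y^n] multiply up from sections of [y] along an orbit of
    letters; one zero factor annihilates the product. *)
Lemma word_power_section n b :
  let u := (word_step (word_power y n) b).1 in
  0 \in map c u \/ word_exponent u = n * word_exponent y.
Proof.
elim: n b => [|n IHn] b; first by right.
rewrite /= /word_power /= -/(word_power y n) word_section_cat.
rewrite /word_exponent map_cat mem_cat exponent_prod_cat mulSn.
case: ifPn => [|/norP[zy zu]]; [by left|right].
rewrite -!/(word_exponent _).
have [/eqP ey|->] := y_section b.
  rewrite /word_exponent exponent_prod_eq0 ?(negbTE zy) // in ey.
  exact/map_neq0/section_neq0.
by have [zu'|->] := IHn (word_step y b).2; first by rewrite zu' in zu.
Qed.

(** A power of [y] is determined by its first-letter data: where it sends each
    letter, and whether its section there is zero. At a letter with nonzero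
    section both powers reproduce themselves, so agreement propagates down the
    tree; where the sections vanish they act alike already. *)
Lemma power_act_eq_first_letter m n :
  (0 < m)%N -> (0 < n)%N ->
  (forall b, let u := word_step (word_power y m) b in
             let v := word_step (word_power y n) b in
             u.2 = v.2 /\ (0 \in map c u.1) = (0 \in map c v.1)) ->
  word_act (word_power y m) =1 word_act (word_power y n).
Proof.
move=> m0 n0 mn; elim=> [|b a IHa]; first by rewrite !word_act_nil.
rewrite !word_act_cons; have /= [-> zmn] := mn b; congr cons.
have powE k w : (0 < k)%N -> w <> [::] ->
    word_exponent w = k * word_exponent y ->
    word_act w =1 word_act (word_power y k).
  move=> k0 w0 ew; apply/act_eqP => //; first exact: word_power_neq0.
  by rewrite ew (word_exponent_power k).2.
have sect0 k : (0 < k)%N -> (word_step (word_power y k) b).1 <> [::].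
  by move=> k0; apply: section_neq0; exact: word_power_neq0.
have [zm|em] := word_power_section m b.
  apply: (iffRL (act_eqP _ _ (sect0 m m0) (sect0 n n0))).
  by rewrite /word_exponent /exponent_prod -zmn zm.
have [zn|en] := word_power_section n b.
  apply: (iffRL (act_eqP _ _ (sect0 m m0) (sect0 n n0))).
  by rewrite /word_exponent /exponent_prod zmn zn.
by rewrite (powE m _ m0 (sect0 m m0) em) (powE n _ n0 (sect0 n n0) en).
Qed.

(** The first-letter data live in a finite type, so the sequence of powers
    repeats itself. *)
Lemma no_self_similar_powers : False.
Proof.
pose data n : {ffun symbol A -> symbol A * bool} :=
  [ffun b => let u := word_step (word_power y n.+1) b in
             (u.2, 0 \in map c u.1)].
suff inj : injective data.
  have := leq_card (fun i : 'I_#|{ffun symbol A -> symbol A * bool}|.+1 =>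
                      data i) (fun i j ij => val_inj (inj _ _ ij)).
  by rewrite card_ord ltnn.
move=> m n /ffunP mn.
have : word_act (word_power y m.+1) =1 word_act (word_power y n.+1).
  apply: power_act_eq_first_letter => // b.
  by have := mn b; rewrite !ffunE => -[].
move/act_eqP; rewrite !(word_exponent_power _).2 => /(_ _ _)/eqP.
rewrite eqn_pmul2r // => mn'.
by apply/succn_inj/eqP/mn'; exact: word_power_neq0.
Qed.
End SelfSimilarPowers.

(** If some exponent is positive, finiteness of the state set provides states of
    extreme positive exponents, and the word balancing them reproduces itself
    or vanishes at every letter. *)
Lemma all_exponents_zero q : c q = 0.
Proof.
apply/eqP; rewrite -[_ == _]negbK -lt0n; apply/negP => q0.
have [qmax qmax0 maxP] := @arg_maxnP _ q (fun r => 0 < c r) c q0.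
have [qmin qmin0 minP] := @arg_minnP _ q (fun r => 0 < c r) c q0.
apply: (@no_self_similar_powers (nseq (c qmin) qmax)) => [|b].
  by rewrite /word_exponent map_nseq exponent_prod_nseq // muln_gt0 qmin0.
apply: balanced_power_section => // r r0.
by apply/andP; split; [exact: minP|exact: maxP].
Qed.
End Exponents.

(** * From subsemigroups of N^0 to exponents *)

Definition N0_exponent (x : N0) : nat := if x is Some n then val n else 0.

(** The code 0 for the adjoined zero is free, as elements of [posnat] are
    positive. *)
Lemma N0_exponent_inj : injective N0_exponent.
Proof.
move=> [[m m0]|] [[n n0]|] //= mn.
- by congr Some; apply: val_inj.
- by move: m0; rewrite mn.
- by move: n0; rewrite -mn.
Qed.

Lemma N0_exponentM (x y : N0) :
  N0_exponent (x * y)%g =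
  if (N0_exponent x == 0) || (N0_exponent y == 0) then 0
  else N0_exponent x + N0_exponent y.
Proof. by case: x y => [[[|m] m0]|] // [[[|n] n0]|]. Qed.

(** The isomorphism gives each state the exponent of the element it represents.
    Two words then act alike exactly when their exponents agree, so all states
    represent zero, and so does every nonempty word. *)
Lemma automaton_subsemigroup_N0_zero {S : set N0} {x} :
  subsemigroup S -> automaton_semigroup S -> S x -> x = N0_zero.
Proof.
move=> [_ mulS] [A [h [hfun hinj hsurj] hM]] Sx.
have /choice[e eP] (q : state A) : exists s, S s /\ h s = word_endo [:: q].
  by have [|s Ss hs] := hsurj (word_endo [:: q]); [exists [:: q]|exists s].
pose c q := N0_exponent (e q).
have wordP (w : seq (state A)) : w <> [::] ->
    exists2 s, S s /\ h s = word_endo w & N0_exponent s = word_exponent c w.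
  elim: w => // q w IHw _; case: w IHw => [_|r w] => [|[]// s [Ss hs] es].
    have [Se he] := eP q; exists (e q) => //.
    by rewrite /word_exponent /exponent_prod /= inE addn0 eq_sym; case: eqP.
  have [Se he] := eP q; exists (e q * s)%g.
    by split; [exact: mulS|rewrite hM // he hs -word_endo_cat].
  by rewrite N0_exponentM es /word_exponent [in RHS]/= exponent_prod_cons.
have act_eqP u v : u <> [::] -> v <> [::] ->
    word_act u =1 word_act v <-> word_exponent c u = word_exponent c v.
  move=> /wordP[s [Ss hs] <-] /wordP[t [St ht] <-]; split=> [uv|/N0_exponent_inj st].
    congr N0_exponent; apply: hinj; rewrite ?inE // hs ht.
    by apply: tree_endo_inj; apply/funext.
  by move=> a; rewrite -[word_act u]/(sval (word_endo u)) -hs st ht.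
have [w w0 hw] := hfun x Sx; have [s [Ss hs] es] := wordP w w0.
have -> : x = s by apply: hinj; rewrite ?inE // hs hw.
apply: N0_exponent_inj; rewrite es; case: w w0 {hw hs es} => // q w _.
by rewrite /word_exponent /exponent_prod /= (all_exponents_zero c act_eqP) inE.
Qed.

Lemma automaton_semigroup_zero : automaton_semigroup [set N0_zero].
Proof.
pose A := @Automaton unit unit id.
have state_id (q : state A) a : state_act q a = a.
  by elim: a => //= x a IHa; congr cons.
have endoE (v w : seq (state A)) : word_endo v = word_endo w.
  have act_id (u : seq (state A)) a : word_act u a = a.
    by elim: u a => //= q u IHu a; rewrite /word_act /= state_id; exact: IHu.
  by apply: tree_endo_inj; apply/funext => a /=; rewrite !act_id.
exists A, (fun=> word_endo [:: tt : state A]).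
  split=> [x _|x y|f [w w0 <-]].
  - by exists [:: tt].
  - by rewrite !inE => -> ->.
  - by exists N0_zero => //; exact: endoE.
by move=> x y _ _; rewrite -word_endo_cat; exact: endoE.
Qed.

Theorem theorem15 (S : set N0) (hS : subsemigroup S) :
  automaton_semigroup S <-> S = [set N0_zero].
Proof.
split=> [autS|->]; last exact: automaton_semigroup_zero.
apply/seteqP; split=> [x Sx|x ->].
  exact: automaton_subsemigroup_N0_zero hS autS Sx.
have [s Ss] := hS.1.
by rewrite -(automaton_subsemigroup_N0_zero hS autS Ss).
Qed.
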